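(* Let $q$ be a prime power. For $n\ge0$ let $\mathcal Q(n)\subset\mathcal P^*_1(n)$ be the set of $*$-symmetric polynomials $f$ (of degree $n$ with $f(0)=1$) such that $f(1),f(-1)\ne0$. Then \[ \sum_{f\in\mathcal Q(n)}\lambda(f)=\begin{cases}1& n=0,\\-1& n=2,\\0& n\ne0,2.\end{cases} \] Hence \[ \sum_{f\in\mathcal P^*(n)}\lambda(f)=\begin{cases}1& n=0,\\-1& n=1\text{ and }2\mid q,\\0& n>1\text{ and }2\mid q,\\2(-1)^n& n\ge1\text{ and }2\nmid q.\end{cases} \]
   Context: All polynomials are monic over $\mathbf F_q$. For $f$ of degree $n$ with $f(0)\ne0$, let $f^*(X)=X^nf(1/X)/f(0)$; $f$ is $*$-symmetric if $f^*=f$. $\mathcal P^*(n)$ is the set of $*$-symmetric polynomials of degree $n$, and $\mathcal P^*_1(n)$ is the subset of those with $f(0)=1$. $\lambda(f)=(-1)^{\Omega(f)}$, where $\Omega(f)$ is the number of irreducible factors of $f$ over $\mathbf F_q$ counted with multiplicity. *)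

(* Defs.v *)
From HB Require Import structures.
From mathcomp Require Import all_boot all_order all_algebra.

Set Implicit Arguments.
Unset Strict Implicit.
Unset Printing Implicit Defensive.

Import GRing.Theory.
Local Open Scope ring_scope.

Section StarSymmetric.

Variable F : finFieldType.
Implicit Types f p : {poly F}.

(* X^n f(1/X) / f(0), where n = (size f).-1 is the degree of f; meaningful
   only when f.[0] != 0. *)
Definition star f : {poly F} :=
  f.[0]^-1 *: \sum_(i < size f) f`_i *: 'X^((size f).-1 - i).

(* With L := {fraction {poly F}} and x := 'X, this is the identity
   f^*(X) = X^n f(1/X) / f(0) of rational functions. *)
Lemma starE (L : fieldType) (iota : {rmorphism F -> L}) f (x : L) :
  x != 0 ->
  (map_poly iota (star f)).[x] =
    x ^+ (size f).-1 * (map_poly iota f).[x^-1] / iota f.[0].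
Proof.
move=> x0; rewrite map_polyZ hornerZ fmorphV mulrC; congr (_ / _).
rewrite rmorph_sum horner_sum (@horner_coef_wide _ (size f)) ?size_map_poly //.
rewrite mulr_sumr; apply: eq_bigr => i _ /=.
rewrite map_polyZ hornerZ map_polyXn hornerXn coef_map /= mulrCA; congr (_ * _).
have le_i : (i <= (size f).-1)%N by rewrite -ltnS (ltn_predK (ltn_ord i)).
by rewrite exprB ?unitfE // exprVn.
Qed.

Definition star_symmetric f : bool := (f.[0] != 0) && (star f == f).

(* {poly_n.+1 F} is the finite type of polynomials of degree at most n. *)
Definition Pstar (n : nat) : {set {poly_n.+1 F}} :=
  [set f : {poly_n.+1 F} |
    [&& polyn f \is monic, size f == n.+1 & star_symmetric f]].

Definition Pstar1 (n : nat) : {set {poly_n.+1 F}} :=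
  [set f in Pstar n | (polyn f).[0] == 1].

Definition Qset (n : nat) : {set {poly_n.+1 F}} :=
  [set f in Pstar1 n | ((polyn f).[1] != 0) && ((polyn f).[-1] != 0)].

(* The multiplicity of a nonconstant p in f != 0; the bound k < size f is
   harmless since then p ^+ k %| f forces k <= deg f. *)
Definition multp p f : nat := \max_(k < size f | p ^+ k %| f) k.

(* Every irreducible factor of f != 0 is associated to a unique monic one, which
   has size at most size f. *)
Definition Omega f : nat :=
  \sum_(p : {poly_(size f) F} | (polyn p \is monic) && irreducibleb p) multp p f.

Definition lambda f : int := (-1) ^+ Omega f.

Lemma multp_prod p (s : seq {poly F}) :
  p \is monic -> irreducible_poly p ->
  (forall r, r \in s -> r \is monic /\ irreducible_poly r) ->
  multp p (\prod_(r <- s) r) = count_mem p s.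
Proof.
move=> mp ip hs; set f := \prod_(r <- s) r; set c := count_mem p s.
have p0 : p != 0 by apply: monic_neq0.
have sp : (1 < size p)%N by case: ip.
set g := \prod_(r <- s | r != p) r.
have eqf : f = p ^+ c * g.
  rewrite /f (bigID (pred1 p)) /=; congr (_ * _).
  rewrite (eq_bigr (fun=> p)) => [|r /eqP-> //].
  by rewrite big_const_seq iter_mulr_1.
have f0 : f != 0.
  by rewrite monic_neq0 // /f big_seq monic_prod // => r /hs[].
have cop : coprimep p g.
  rewrite /g big_seq_cond.
  apply: (big_ind (fun u => coprimep p u)) => [|u v pu pv|r /andP[rs rp]].
  - exact: coprimep1.
  - by rewrite coprimepMr pu pv.
  have [mr [_ ir]] := hs r rs; rewrite irreducible_poly_coprime //.
  apply/negP => dpr; have := ir p _ dpr; rewrite (gtn_eqF sp) => /(_ isT).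
  by rewrite eqp_monic // eq_sym (negPf rp).
have dvdc (k : nat) : (p ^+ k %| f) = (k <= c)%N.
  by rewrite eqf Gauss_dvdpl ?coprimep_expl // dvdp_Pexp2l.
have lt_c : (c < size f)%N.
  rewrite (@leq_trans (size (p ^+ c))) ?dvdp_leq ?dvdc //.
  rewrite -(@prednK (size (p ^+ c))) ?size_poly_gt0 ?expf_neq0 //.
  by rewrite size_exp ltnS leq_pmull // -subn1 subn_gt0.
apply/eqP; rewrite eqn_leq; apply/andP; split.
  by apply/bigmax_leqP => k; rewrite dvdc.
rewrite (bigmax_sup (Ordinal lt_c)) ?dvdc //.
Qed.

Lemma Omega_prod (s : seq {poly F}) :
  (forall r, r \in s -> r \is monic /\ irreducible_poly r) ->
  Omega (\prod_(r <- s) r) = size s.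
Proof.
move=> hs; rewrite /Omega; set f := \prod_(r <- s) r.
have f0 : f != 0.
  by rewrite monic_neq0 // /f big_seq monic_prod // => r /hs[].
under eq_bigr => p /andP[mp /irreducibleP ip] do
  rewrite multp_prod // -sum1_count big_mkcond.
rewrite exchange_big /= -(sum1_size s) big_seq [RHS]big_seq.
apply: eq_bigr => r rs; have [mr /irreducibleP ir] := hs r rs.
have szr : r \is a poly_of_size (size f).
  rewrite qualifE /= dvdp_leq // /f (big_rem r) //=; exact: dvdp_mulr.
rewrite (bigD1 (NPoly szr)) /= ?mr ?ir // eqxx big1 ?addn0 // => p /andP[_ pr].
by rewrite ifN // eq_sym.
Qed.

End StarSymmetric.

(* Main.v *)
Require Import Defs.
From mathcomp Require Import all_boot all_order all_algebra all_field zify ring.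

Set Implicit Arguments.
Unset Strict Implicit.
Unset Printing Implicit Defensive.

Import GRing.Theory.
Local Open Scope ring_scope.

(** Every [f] in Q(n) has even degree, so only [L(m)], the sum of [lambda] over
    Q(2m), is at stake. Call palindromic the monic symmetric polynomials with
    constant coefficient 1 and even degree. The key is the identity

      sum of [lambda d] over the [d] in Q dividing [f]
        = number of monic [g] such that [g * star g = f],

    for [f] palindromic ([lambda_sum_count_norm_root]). It is the analogue of the
    fact that the divisor sum of the Liouville function is the indicator of squares.
    Both sides are multiplicative, and symmetric polynomials factor into irreducible
    [p = star p], with [lambda p = -1], and products [p * star p], with
    [lambda (p * star p) = 1]. To avoid factorisations, the identity is obtained by
    showing that both sides satisfy the same recurrence when [f] is multiplied by
    such a factor ([lambda_sum_rec], [count_norm_root_symm], [count_norm_root_rec]);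
    the factors [X - 1] and [X + 1], invisible to Q, have even multiplicity
    ([even_palin_XsubC]).

    Sum the identity over the palindromic [f] of degree [2m]. There are [q^m] of
    these, since half of the coefficients are free ([count_palin]), so the left side
    becomes the sum over [k <= m] of [L(k) q^(m - k)]. The right side becomes the
    number of monic [g] of degree [m] with [g(0) <> 0], which is [q^m - q^(m - 1)] if
    [m > 0] and 1 if [m = 0]. Subtracting [q] times the relation for [m - 1] from the
    relation for [m] leaves [L(0) = 1], [L(1) = -1] and [L(m) = 0] for [m > 1]
    ([Qsum_value]). In terms of generating functions,
    [L(u) / (1 - q u) = (1 - u) / (1 - q u)].

    For the sum over all symmetric polynomials, those vanishing at 1 are the multiples
    by [X - 1] of symmetric polynomials of degree one less, and [lambda (X - 1) = -1];
    for [q] odd the same holds independently for -1. Each of these roots yields a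
    one-step recurrence ([symm_sumS]), solved in [symm_sum_predT_value]. *)

Section Star.

Variable F : finFieldType.
Implicit Types f g p d e S : {poly F}.

(** * The reciprocal polynomial *)

Lemma star_poly f :
  star f = f.[0]^-1 *: \poly_(i < size f) f`_((size f).-1 - i).
Proof.
congr (_ *: _); rewrite poly_def (reindex_inj rev_ord_inj) /=.
apply: eq_bigr => i _; have := ltn_ord i.
case: (size f) (nat_of_ord i) => // n {}i; rewrite ltnS => le_in /=.
by rewrite subSS subKn.
Qed.

Lemma coef_star f i : (i < size f)%N ->
  (star f)`_i = f`_((size f).-1 - i) / f.[0].
Proof. by move=> ltif; rewrite star_poly coefZ coef_poly ltif mulrC. Qed.

Lemma horner0_neq0 f : f.[0] != 0 -> f != 0.
Proof. by apply: contraNneq => ->; rewrite horner0. Qed.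

Lemma size_star f : f.[0] != 0 -> size (star f) = size f.
Proof.
move=> f0; rewrite star_poly size_scale ?invr_eq0 // size_poly_eq //.
by rewrite subnn -horner_coef0.
Qed.

Lemma monic_star f : f.[0] != 0 -> star f \is monic.
Proof.
move=> f0; rewrite monicE lead_coefE size_star // coef_star.
  by rewrite subnn -horner_coef0 divff.
by rewrite ltn_predL size_poly_gt0 horner0_neq0.
Qed.

Lemma star_horner0 f : f.[0] != 0 -> (star f).[0] = lead_coef f / f.[0].
Proof.
move=> f0; rewrite horner_coef0 coef_star ?subn0 //.
by rewrite size_poly_gt0 horner0_neq0.
Qed.

Lemma star_horner0_neq0 f : f.[0] != 0 -> (star f).[0] != 0.
Proof.
move=> f0; rewrite star_horner0 // mulf_neq0 ?invr_eq0 //.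
by rewrite lead_coef_eq0 horner0_neq0.
Qed.

Lemma starK f : f \is monic -> f.[0] != 0 -> star (star f) = f.
Proof.
move=> mf f0; apply/polyP => i.
have [ltif|leif] := ltnP i (size f); last first.
  by rewrite !nth_default // !size_star // star_horner0_neq0.
have le1 : (i <= (size f).-1)%N by rewrite -ltnS (ltn_predK ltif).
rewrite coef_star size_star // coef_star; last first.
  by rewrite -(ltn_predK ltif) ltnS leq_subr.
by rewrite subKn // star_horner0 // (monicP mf) mul1r invrK divfK.
Qed.

(** In the field of fractions, [star f] is [X^n f(1/X) / f(0)], and each of the
    three factors of this expression is multiplicative in [f]. *)
Lemma starM f g : f.[0] != 0 -> g.[0] != 0 -> star (f * g) = star f * star g.
Proof.
move=> f0 g0; have [nzf nzg] := (horner0_neq0 f0, horner0_neq0 g0).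
pose iota := (@FracField.tofrac {poly F}) \o polyC : {rmorphism F -> _}.
pose x : {fraction {poly F}} := FracField.tofrac 'X.
have x0 : x != 0 by rewrite tofrac_eq0 polyX_eq0.
have evE p : (map_poly iota p).[x] = FracField.tofrac p.
  rewrite /iota /x map_poly_comp horner_map; congr FracField.tofrac.
  exact: comp_polyXr.
apply/eqP; rewrite -tofrac_eq tofracM -!evE !starE //; apply/eqP.
have -> : (size (f * g)).-1 = ((size f).-1 + (size g).-1)%N.
  rewrite size_mul //; case: (size f) (size_poly_gt0 f) => [|a] /=.
    by rewrite nzf.
  case: (size g) (size_poly_gt0 g) => [|b] /=; first by rewrite nzg.
  by rewrite addnS.
rewrite exprD (rmorphM (map_poly iota)) !hornerM (rmorphM iota) invfM.
by rewrite [X in X * _ = _]mulrACA [LHS]mulrACA.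
Qed.

Lemma star1 : star (1 : {poly F}) = 1.
Proof.
rewrite star_poly hornerC invr1 scale1r size_poly1 poly_def big_ord1.
by rewrite coef1 scale1r expr0.
Qed.

Lemma star_dvdp d f : f.[0] != 0 -> d %| f -> star d %| star f.
Proof.
move=> f0 /dvdpP[e Df]; move: f0; rewrite Df hornerM mulf_eq0 negb_or.
by case/andP=> e0 d0; rewrite starM // dvdp_mull.
Qed.

Lemma dvdp_horner0_neq0 d f : f.[0] != 0 -> d %| f -> d.[0] != 0.
Proof.
move=> f0 /dvdpP[e Df]; apply: contraNneq f0.
by rewrite Df hornerM => ->; rewrite mulr0.
Qed.

(** [star] maps the divisors of [star p] to divisors of [p] of the same
    size, so a proper divisor of the former would give one of the latter. *)
Lemma irreducible_star p : p \is monic -> p.[0] != 0 ->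
  irreducible_poly p -> irreducible_poly (star p).
Proof.
move=> mp p0 [sp ip]; split=> [|q sq dq]; first by rewrite size_star.
have q0 := dvdp_horner0_neq0 (star_horner0_neq0 p0) dq.
have dsq : star q %| p.
  by rewrite -[p](starK mp p0) star_dvdp ?star_horner0_neq0.
rewrite -dvdp_size_eqp // size_star // -(size_star q0) dvdp_size_eqp //.
by apply: ip; rewrite ?size_star.
Qed.

(** * Monic symmetric polynomials *)

Definition symm f := (f \is monic) && star_symmetric f.

Lemma symmP f : reflect [/\ f \is monic, f.[0] != 0 & star f = f] (symm f).
Proof. by apply: (iffP and3P) => [[? ? /eqP]|[? ? ->]] //; split. Qed.

(** Multiplicativity of [star] makes symmetry pass to cofactors, which keeps every
    division of the proof inside the symmetric polynomials. *)
Lemma symmMl f g : symm f -> symm (f * g) = symm g.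
Proof.
case/symmP=> mf f0 sf; apply/symmP/symmP => [] [mg g0 sg].
  rewrite (monicMl _ mf) in mg; split=> //.
    by apply: contraNneq g0; rewrite hornerM => ->; rewrite mulr0.
  move: g0; rewrite hornerM mulf_eq0 negb_or => /andP[_ g0].
  apply: (mulfI (monic_neq0 mf)).
  by rewrite -{1}sf -starM.
split; first by rewrite monicMl.
- by rewrite hornerM mulf_neq0.
by rewrite starM // sf sg.
Qed.

Lemma symm1 : symm 1.
Proof. by apply/symmP; split; rewrite ?monic1 ?hornerC ?oner_eq0 ?star1. Qed.

Lemma symm_mul_star p : p \is monic -> p.[0] != 0 -> symm (p * star p).
Proof.
move=> mp p0; have s0 := star_horner0_neq0 p0.
apply/symmP; split.
- by rewrite monicMl ?monic_star.
- by rewrite hornerM mulf_neq0.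
by rewrite starM // starK // mulrC.
Qed.

Lemma horner0_mul_star p : p \is monic -> p.[0] != 0 -> (p * star p).[0] = 1.
Proof.
by move=> mp p0; rewrite hornerM star_horner0 // (monicP mp) mulrC divfK.
Qed.

Lemma symm_XsubC (c : F) : c ^+ 2 = 1 -> symm ('X - c%:P).
Proof.
move=> c2; have c0 : c != 0.
  by apply: contra_eqN c2 => /eqP ->; rewrite expr0n eq_sym oner_eq0.
have h0 : ('X - c%:P).[0] = - c by rewrite hornerXsubC sub0r.
apply/symmP; split; rewrite ?monicXsubC ?h0 ?oppr_eq0 //.
apply/polyP => i; case: (ltnP i 2) => [lti|lei]; last first.
  by rewrite !nth_default ?size_star ?size_XsubC // h0 oppr_eq0.
have cV : c^-1 = c by apply: (mulfI c0); rewrite mulfV // -expr2 c2.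
rewrite coef_star size_XsubC // h0 !coefB !coefX !coefC invrN cV.
case: i lti => [|[|]] //= _;
  by rewrite ?subr0 ?sub0r ?mul1r ?mulrNN -?expr2 ?c2.
Qed.

(** The coefficients at [i] and [n - i] agree, while [(-1)^i] and [(-1)^(n-i)] are
    opposite for odd [n], so the terms of [f(-1)] cancel in pairs. Unlike the
    argument [f(-1) = - f(-1)], this covers characteristic 2. *)
Lemma symm_odd_root f : symm f -> f.[0] = 1 -> ~~ odd (size f) -> f.[-1] = 0.
Proof.
case/symmP=> mf _ sf f0 odd_f.
(* The second half of the sum is reversed to face the first one. *)
have [k Dk] : exists k, size f = (k + k)%N.
  by exists (size f)./2; rewrite addnn even_halfK.
rewrite horner_coef Dk big_split_ord /=.
rewrite [X in _ + X](reindex_inj rev_ord_inj) /=.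
rewrite -big_split big1 //= => i _.
have lti := ltn_ord i.
have Di : f`_(k + (k - i.+1)) = f`_i.
  rewrite -[in LHS]sf coef_star ?Dk; last lia.
  by rewrite f0 divr1; congr f`_ _; lia.
rewrite Di; have -> : (k + (k - i.+1) = i + (k - i.+1).*2.+1)%N by lia.
by rewrite exprD exprS -mul2n exprM sqrrN !expr1n; ring.
Qed.

(** * Factorisation and the Liouville function *)

Lemma monic_size_eq1 f : f \is monic -> (size f == 1) = (f == 1).
Proof. by move=> mf; rewrite size_poly_eq1 eqp_monic ?monic1. Qed.

Lemma exists_irreducible f : (1 < size f)%N ->
  exists p, [/\ p \is monic, irreducible_poly p & p %| f].
Proof.
have [n] := ubnP (size f); elim: n f => // n IH f ltfn sf.
have f0 : f != 0 by rewrite -size_poly_gt0 ltnW.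
have [/irreducibleP irf|] := boolP (irreducibleb f).
  have lf0 : lead_coef f != 0 by rewrite lead_coef_eq0.
  have lfV : (lead_coef f)^-1 != 0 by rewrite invr_eq0.
  exists ((lead_coef f)^-1 *: f); split.
  - by rewrite monicE lead_coefZ mulVf.
  - split=> [|q sq]; first by rewrite size_scale.
    rewrite dvdpZr // => qf.
    by apply: (eqp_trans (irf.2 q sq qf)); rewrite eqp_sym eqp_scale.
  - by rewrite dvdpZl.
rewrite /irreducibleb sf /= negb_forall => /existsP[q].
rewrite negb_imply -ltnNge => /andP[/= dq sq].
have [|p [mp ip dp]] := IH q _ sq.
  by apply: leq_ltn_trans (size_npoly q) _; rewrite -ltnS prednK // ltnW.
by exists p; split=> //; apply: dvdp_trans dp _; rewrite dvdpE.
Qed.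

Lemma monic_factor f : f \is monic ->
  exists2 s : seq {poly F}, f = \prod_(p <- s) p &
    forall p, p \in s -> p \is monic /\ irreducible_poly p.
Proof.
have [n] := ubnP (size f); elim: n f => // n IH f ltfn mf.
have f0 := monic_neq0 mf.
case: (ltnP 1 (size f)) => [sf|sf]; last first.
  exists [::] => //; rewrite big_nil; apply/eqP.
  by rewrite -monic_size_eq1 // eqn_leq sf size_poly_gt0.
have [p [mp ip /dvdpP[g Df]]] := exists_irreducible sf.
have mg : g \is monic by rewrite Df monicMr in mf.
have [|s Dg hs] := IH g _ mg.
  have := monic_neq0 mg; rewrite -size_poly_gt0 => g_gt0.
  move: ltfn; rewrite Df size_mul ?monic_neq0 //.
  by case: ip => + _; move: g_gt0; move: (size g) (size p) => a b; lia.
exists (p :: s) => [|r]; first by rewrite big_cons -Dg Df mulrC.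
by rewrite inE => /orP[/eqP->|/hs].
Qed.

Lemma lambdaM f g : f \is monic -> g \is monic ->
  lambda (f * g) = lambda f * lambda g.
Proof.
move=> /monic_factor[s -> hs] /monic_factor[t -> ht].
rewrite /lambda -big_cat !Omega_prod //=; first by rewrite size_cat exprD.
by move=> p; rewrite mem_cat => /orP[/hs|/ht].
Qed.

Lemma lambda1 : lambda (1 : {poly F}) = 1.
Proof. by have := @Omega_prod F [::]; rewrite big_nil /lambda => ->. Qed.

Lemma lambda_irreducible p : p \is monic -> irreducible_poly p -> lambda p = -1.
Proof.
move=> mp ip; have := @Omega_prod F [:: p]; rewrite big_seq1 /lambda => -> //.
by move=> r; rewrite inE => /eqP->.
Qed.

Lemma irreducible_dvdpM p f g : irreducible_poly p ->
  (p %| f * g) = (p %| f) || (p %| g).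
Proof.
move=> ip; have [pf|npf] /= := boolP (p %| f); first exact: dvdp_mulr.
by rewrite Gauss_dvdpr // irreducible_poly_coprime.
Qed.

Lemma monic_irreducible_eq p r : p \is monic -> r \is monic ->
  irreducible_poly p -> irreducible_poly r -> p %| r -> p = r.
Proof.
move=> mp mr ip ir pr; apply/eqP; rewrite -eqp_monic //.
by apply: ir.2 => //; rewrite neq_ltn ip.1 orbT.
Qed.

(** * Palindromic polynomials of even degree, and the set Q *)

(** Symmetric with constant coefficient 1 and even degree. This is the family over
    which the main identity is summed: it contains the union of the Q(n), is stable
    under products and cofactors, and has exactly [q^m] members in degree [2m]. *)
Definition even_palin f := [&& symm f, f.[0] == 1 & odd (size f)].
Definition inQ f := [&& symm f, f.[1] != 0 & f.[-1] != 0].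

(** Evaluating [star f = f] at 1 gives [f(1) = f(1) / f(0)]. *)
Lemma symm_horner1 f : symm f -> f.[0] != 1 -> f.[1] = 0.
Proof.
case/symmP=> mf f0 sf; apply: contraNeq => f1.
have := starE (GRing.RMorphism.clone _ _ (@idfun F) _) f (oner_neq0 F).
rewrite !map_poly_id // sf expr1n mul1r invr1 => E.
have /(mulfI f1) E' : f.[1] * f.[0] = f.[1] * 1 by rewrite {1}E divfK ?mulr1.
exact/eqP.
Qed.

(** A symmetric polynomial with [f(0) <> 1] vanishes at 1 ([symm_horner1]), and one
    with [f(0) = 1] and odd degree vanishes at -1 ([symm_odd_root]). In particular, Q(n)
    is empty for odd [n]. *)
Lemma inQ_even_palin f : inQ f -> even_palin f.
Proof.
case/and3P=> sf f1 fN1; have f0 : f.[0] = 1.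
  by apply/eqP; apply: contraNT f1 => /(symm_horner1 sf) ->.
rewrite /even_palin sf f0 eqxx /=; apply: contraNT fN1 => odd_f.
by rewrite symm_odd_root.
Qed.

Lemma size_mul_monic f g : f \is monic -> g \is monic ->
  size (f * g) = (size f + size g).-1.
Proof. by move=> mf mg; rewrite size_mul ?monic_neq0. Qed.

Lemma symm_monic f : symm f -> f \is monic. Proof. by case/symmP. Qed.
Lemma symm_horner0 f : symm f -> f.[0] != 0. Proof. by case/symmP. Qed.
Lemma symm_star f : symm f -> star f = f. Proof. by case/symmP. Qed.
Lemma even_palin_symm f : even_palin f -> symm f. Proof. by case/and3P. Qed.
Lemma inQ_symm f : inQ f -> symm f. Proof. by case/and3P. Qed.
Lemma monic_size_gt0 f : f \is monic -> (0 < size f)%N.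
Proof. by move=> mf; rewrite size_poly_gt0 monic_neq0. Qed.

Lemma even_palinMl f g : even_palin f -> even_palin (f * g) = even_palin g.
Proof.
case/and3P=> sf /eqP f0 of_; rewrite /even_palin symmMl // hornerM f0 mul1r.
apply/andb_id2l => /symm_monic mg; congr (_ && _).
have mf := symm_monic sf; rewrite size_mul_monic //.
have := monic_size_gt0 mf; have := monic_size_gt0 mg; lia.
Qed.

Lemma inQ_Ml f g : symm f -> inQ (f * g) = inQ f && inQ g.
Proof.
move=> sf; rewrite /inQ symmMl // sf /= !hornerM !mulf_eq0 !negb_or.
by case: symm; rewrite ?andbF //=; case: eqP; case: eqP; case: eqP; case: eqP.
Qed.

Lemma inQ1 : inQ 1.
Proof. by rewrite /inQ symm1 !hornerC !oner_eq0. Qed.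

Lemma even_palin1 : even_palin 1. Proof. exact/inQ_even_palin/inQ1. Qed.

(** The multiplicity of [X - c], for [c = 1] or [c = -1], is even: removing one
    factor [X + 1] leaves an odd degree, removing one factor [X - 1] leaves the
    constant coefficient -1, and either forces another root at [c]. *)
Lemma even_palin_XsubC (c : F) f :
  c ^+ 2 = 1 -> even_palin (('X - c%:P) * f) -> f.[c] = 0.
Proof.
move=> c2 /and3P[]; rewrite symmMl ?symm_XsubC // => sf.
rewrite hornerM hornerXsubC sub0r mulNr => /eqP f0 odd_f.
have [cN1|cN1] := eqVneq c (-1).
  rewrite cN1; apply: (symm_odd_root sf).
    by move: f0; rewrite cN1 mulN1r opprK.
  have mf := symm_monic sf; move: odd_f.
  rewrite size_mul_monic ?monicXsubC // size_XsubC /=.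
  by have := monic_size_gt0 mf; lia.
have c1 : c = 1.
  by move/eqP: c2; rewrite sqrf_eq1 (negPf cN1) orbF => /eqP.
rewrite c1; apply: symm_horner1 => //; apply: contraNneq cN1 => f01.
by move: f0; rewrite f01 mulr1 => <-; rewrite opprK.
Qed.

(** * Sums over polynomials of bounded size *)

(** Reindexing along [e |-> S * e]. All the bijections of the proof that consist in
    dividing by a fixed polynomial are instances of this lemma; the predicates [A]
    and [B] control the sizes, so that the two bounds [M] and [N] are independent. *)
Lemma sum_mulp (M N : nat) S (A B : pred {poly F}) (phi : {poly F} -> int) :
  S != 0 -> (forall e, B (S * e) = A e) -> (forall d, B d -> S %| d) ->
  (forall e, A e -> (size e <= M)%N) -> (forall d, B d -> (size d <= N)%N) ->
  \sum_(d : {poly_N F} | B (polyn d)) phi (polyn d) =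
  \sum_(e : {poly_M F} | A (polyn e)) phi (S * polyn e).
Proof.
move=> S0 BA BS sA sB.
have Be d : B d -> exists2 e, d = S * e & (size e <= M)%N.
  move=> Bd; have /dvdpP[e De] := BS d Bd; exists e; first by rewrite mulrC.
  by apply: sA; rewrite -BA mulrC -De.
rewrite (reindex_onto (fun e : {poly_M F} => npolyp N (S * polyn e))
   (fun d : {poly_N F} => npolyp M (polyn d %/ S))) /=; last first.
  move=> d Bd; apply: val_inj; have [e De se] := Be _ Bd.
  by rewrite /= De mulKp // (npolypK se) npolypK // -De.
have sN e : A e -> (size (S * e)%R <= N)%N by move=> Ae; apply: sB; rewrite BA.
have pA (e : {poly_M F}) : B (npolyp N (S * polyn e)) &&
      (npolyp M (npolyp N (S * polyn e) %/ S) == e) = A (polyn e).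
  apply/andP/idP => [[Bd /eqP De]|Ae].
    have [e' De' se'] := Be _ Bd.
    by move: De Bd; rewrite De' mulKp // => <-; rewrite BA npolypK.
  rewrite npolypK ?sN // BA; split=> //; apply/eqP/val_inj.
  by rewrite /= mulKp // npolypK.
rewrite (eq_bigl _ _ pA); apply: eq_bigr => e Ae.
by rewrite npolypK ?sN.
Qed.

(** The bound on the size is immaterial as long as it contains the support. *)
Lemma sum_npoly_eq (M N : nat) (A : pred {poly F}) (phi : {poly F} -> int) :
  (forall e, A e -> (size e <= M)%N) -> (forall e, A e -> (size e <= N)%N) ->
  \sum_(d : {poly_N F} | A (polyn d)) phi (polyn d) =
  \sum_(d : {poly_M F} | A (polyn d)) phi (polyn d).
Proof.
move=> sM sN; rewrite (@sum_mulp M N 1 A A) ?oner_eq0 //.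
- by apply: eq_bigr => d _; rewrite mul1r.
- by move=> e; rewrite mul1r.
by move=> d _; rewrite dvd1p.
Qed.

(** * The divisor sum of lambda over Q *)

(** The value at [f] of the Dirichlet convolution of [1] with [lambda] restricted
    to Q. *)
Definition lambda_sum f : int :=
  \sum_(d : {poly_(size f) F} | inQ (polyn d) && (polyn d %| f))
     lambda (polyn d).

Definition lambda_sum_free S f : int :=
  \sum_(d : {poly_(size f) F} |
     inQ (polyn d) && (polyn d %| f) && ~~ (S %| polyn d)) lambda (polyn d).

(** [g * star g] is the norm of [g] for the involution [star]. *)
Definition norm_root f g := [&& g \is monic, g.[0] != 0 & g * star g == f].

Definition count_norm_root f : int :=
  \sum_(g : {poly_(size f) F} | norm_root f (polyn g)) 1.

Definition count_norm_root_free p f : int :=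
  \sum_(g : {poly_(size f) F} | norm_root f (polyn g) && ~~ (p %| polyn g)) 1.

Lemma size_norm_root f g : norm_root f g -> (size g <= size f)%N.
Proof.
case/and3P=> mg g0 /eqP <-; apply: dvdp_leq; last exact: dvdp_mulr.
by rewrite mulf_neq0 ?monic_neq0 ?monic_star.
Qed.

(** [S] behaves as a prime among symmetric polynomials. Such are the irreducible
    [p = star p] and the products [p * star p] with [p <> star p] irreducible. *)
Definition symm_prime S := forall d, symm d -> ~~ (S %| d) -> coprimep d S.

Lemma lambda_sum_mul S f : inQ S -> f \is monic ->
  lambda_sum (S * f) = lambda S * lambda_sum f + lambda_sum_free S (S * f).
Proof.
move=> QS mf; have mS := symm_monic (inQ_symm QS); have S0 := monic_neq0 mS.
have f0 := monic_neq0 mf.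
rewrite /lambda_sum (bigID (fun d : {poly_ _ F} => S %| polyn d)) /=.
congr (_ + _).
rewrite (@sum_mulp (size f) _ S (fun d => inQ d && (d %| f))
   (fun d => inQ d && (d %| S * f) && (S %| d))) //=.
- rewrite mulr_sumr; apply: eq_bigr => d /andP[/inQ_symm/symm_monic md _].
  by rewrite lambdaM.
- by move=> e; rewrite inQ_Ml ?inQ_symm // QS dvdp_mul2l // dvdp_mulr ?andbT.
- by move=> d /andP[].
- by move=> e /andP[_ /dvdp_leq->].
by move=> d /andP[/andP[_ /dvdp_leq->]] //; rewrite mulf_neq0.
Qed.

Lemma lambda_sum_free_mul S f : symm_prime S -> S * f != 0 ->
  lambda_sum_free S (S * f) = lambda_sum_free S f.
Proof.
move=> pS Sf0; move: (Sf0); rewrite mulf_eq0 negb_or => /andP[S0 f0].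
rewrite /lambda_sum_free -(@sum_npoly_eq (size f) (size (S * f))
   (fun d => inQ d && (d %| f) && ~~ (S %| d))) /=.
- apply: eq_bigl => d; apply/andb_id2r => Sd; apply/andb_id2l => Qd.
  by rewrite Gauss_dvdpr // pS ?inQ_symm.
- by move=> e /andP[/andP[_ /dvdp_leq->]].
by move=> e /andP[/andP[_ de _]]; rewrite dvdp_leq // dvdp_mull.
Qed.

Lemma lambda_sum_free_id S f :
  ~~ (S %| f) -> lambda_sum_free S f = lambda_sum f.
Proof.
move=> nSf; apply: eq_bigl => d; case: (inQ _) => //=.
case: (boolP (polyn d %| f)) => //= df.
by apply: contra nSf => Sd; apply: dvdp_trans df.
Qed.

(** Splitting the divisors of [S * f] according to divisibility by [S] gives
    [lambda_sum (S * f) = lambda S * lambda_sum f + r], where [r] runs over the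
    divisors prime to [S] and does not change when [f] is multiplied by [S].
    Eliminating [r] gives a second-order recurrence, with an initial condition,
    along the powers of [S]. *)
Lemma lambda_sum_rec S f : inQ S -> symm_prime S -> f \is monic ->
    (~~ (S %| f) -> lambda_sum (S * f) = (lambda S + 1) * lambda_sum f)
 /\ (lambda_sum (S * (S * f)) =
       (lambda S + 1) * lambda_sum (S * f) - lambda S * lambda_sum f).
Proof.
move=> QS pS mf; have mS := symm_monic (inQ_symm QS).
have f0 := monic_neq0 mf; have S0 := monic_neq0 mS.
have mSf : S * f \is monic by rewrite monicMl.
split=> [nSf|].
  rewrite lambda_sum_mul // lambda_sum_free_mul ?mulf_neq0 //.
  by rewrite lambda_sum_free_id // mulrDl mul1r.
rewrite lambda_sum_mul // lambda_sum_free_mul ?mulf_neq0 //.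
by rewrite (lambda_sum_mul QS mf); ring.
Qed.

Lemma inQ_coprimep_XsubC (c : F) d : c ^+ 2 = 1 -> inQ d ->
  coprimep d ('X - c%:P).
Proof.
move=> c2 /and3P[_ d1 dN1]; rewrite coprimep_XsubC /root.
by move/eqP: c2; rewrite sqrf_eq1 => /orP[] /eqP->.
Qed.

(** Divisors in Q have no common factor with [X - 1] and [X + 1]. *)
Lemma lambda_sum_XsubC (c : F) f : c ^+ 2 = 1 -> f != 0 ->
  lambda_sum (('X - c%:P) * (('X - c%:P) * f)) = lambda_sum f.
Proof.
move=> c2 f0; set P := 'X - c%:P; have P0 : P != 0 by rewrite polyXsubC_eq0.
rewrite /lambda_sum -(@sum_npoly_eq (size f) (size (P * (P * f)))
   (fun d => inQ d && (d %| f))) /=.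
- apply: eq_bigl => d; apply/andb_id2l => Qd.
  by rewrite !Gauss_dvdpr ?inQ_coprimep_XsubC.
- by move=> e /andP[_ /dvdp_leq->].
by move=> e /andP[_ de]; rewrite dvdp_leq ?mulf_neq0 // !dvdp_mull.
Qed.

(** * Counting the solutions of g * star g = f *)

Lemma norm_root_mul p e f : p \is monic -> p.[0] != 0 ->
  norm_root (p * star p * f) (p * e) = norm_root f e.
Proof.
move=> mp p0; rewrite /norm_root monicMl // hornerM mulf_eq0 negb_or p0 /=.
apply/andb_id2l => me; apply/andb_id2l => e0.
rewrite starM // mulrACA (inj_eq (mulfI _)) //.
by rewrite mulf_neq0 ?monic_neq0 ?monic_star.
Qed.

Lemma norm_root_dvd f g p : p \is monic -> p.[0] != 0 -> irreducible_poly p ->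
  norm_root f g -> p %| f -> (p %| g) || (star p %| g).
Proof.
move=> mp p0 ip /and3P[mg g0 /eqP <-]; rewrite irreducible_dvdpM //.
case/orP=> [-> //|dpg]; apply/orP; right.
by rewrite -(starK mg g0) star_dvdp // star_horner0_neq0.
Qed.

(** As [p = star p] divides [g] exactly when it divides [star g], it divides
    [g * star g] an even number of times. *)
Lemma count_norm_root_symm p f : symm p -> irreducible_poly p -> f \is monic ->
  (~~ (p %| f) -> count_norm_root (p * f) = 0) /\
  count_norm_root (p * (p * f)) = count_norm_root f.
Proof.
move=> /symmP[mp p0 sp] ip mf.
have pg f1 g : norm_root (p * f1) g -> p %| g.
  move=> /norm_root_dvd/(_ (dvdp_mulr _ (dvdpp p))) H.
  by have := H mp p0 ip; rewrite sp orbb.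
split=> [npf|].
  apply: big1 => g sg; case/negP: npf.
  rewrite -(@dvdp_mul2l _ p) ?monic_neq0 //.
  have /and3P[mg g0 /eqP <-] := sg; have pdg := pg _ _ sg.
  by rewrite dvdp_mul // -{1}sp star_dvdp.
rewrite /count_norm_root.
rewrite (@sum_mulp (size f) _ p (norm_root f) _ (fun=> 1)) ?monic_neq0 //.
- by move=> e; rewrite mulrA -{2}sp norm_root_mul.
- exact: pg.
- exact: size_norm_root.
exact: size_norm_root.
Qed.

Lemma count_norm_root_mul p f : p \is monic -> p.[0] != 0 ->
  count_norm_root (p * star p * f) =
  count_norm_root f + count_norm_root_free p (p * star p * f).
Proof.
move=> mp p0; rewrite {1}/count_norm_root.
rewrite (bigID (fun d : {poly_ _ F} => p %| polyn d)) /=.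
congr (_ + _).
rewrite (@sum_mulp (size f) _ p (norm_root f)
  (fun g => norm_root (p * star p * f) g && (p %| g)) (fun=> 1)) ?monic_neq0 //.
- by move=> e; rewrite norm_root_mul // dvdp_mulr ?andbT.
- by move=> d /andP[].
- exact: size_norm_root.
by move=> d /andP[/size_norm_root].
Qed.

(** If [g * star g] is divisible by [p] and [g] is not, then [star g] is, that is,
    [star p] divides [g]: dividing [g] by [star p] is the required bijection. *)
Lemma count_norm_root_free_mul p f :
  p \is monic -> p.[0] != 0 -> irreducible_poly p -> star p != p ->
  count_norm_root_free p (p * star p * f) = count_norm_root_free p f.
Proof.
move=> mp p0 ip np; have ms := monic_star p0; have s0 := star_horner0_neq0 p0.
rewrite /count_norm_root_free (@sum_mulp (size f) _ (star p)
  (fun g => norm_root f g && ~~ (p %| g))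
  (fun g => norm_root (p * star p * f) g && ~~ (p %| g)) (fun=> 1))
  ?monic_neq0 //.
- move=> e; rewrite -{1}(starK mp p0) [_ * star p]mulrC norm_root_mul //.
  rewrite irreducible_dvdpM //; congr (_ && ~~ _).
  case: (boolP (p %| star p)) => //= dp; case/eqP: np.
  by apply/esym/monic_irreducible_eq => //; apply: irreducible_star.
- move=> d /andP[sd npd]; have := norm_root_dvd mp p0 ip sd.
  by rewrite -mulrA dvdp_mulr // (negPf npd) => /(_ isT).
- by move=> e /andP[/size_norm_root].
by move=> e /andP[/size_norm_root].
Qed.

Lemma count_norm_root_free_id p f : p \is monic -> p.[0] != 0 ->
  ~~ (p * star p %| f) -> count_norm_root_free p f = count_norm_root f.
Proof.
move=> mp p0 nf; apply: eq_bigl => g.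
case: (boolP (norm_root f _)) => //= /and3P[mg g0 /eqP Df].
by apply: contra nf => dp; rewrite -Df dvdp_mul // star_dvdp.
Qed.

(** The recurrence of [lambda_sum_rec] for [S = p * star p], whose [lambda] is 1,
    with the solutions [g] divisible by [p] in the place of the divisors divisible
    by [S]. *)
Lemma count_norm_root_rec p f :
  p \is monic -> p.[0] != 0 -> irreducible_poly p -> star p != p -> let S := p * star p in
    (~~ (S %| f) -> count_norm_root (S * f) = 2 * count_norm_root f) /\
    count_norm_root (S * (S * f)) =
      2 * count_norm_root (S * f) - count_norm_root f.
Proof.
move=> mp p0 ip np S; split=> [nSf|].
  rewrite count_norm_root_mul // count_norm_root_free_mul //.
  by rewrite count_norm_root_free_id //; ring.
rewrite count_norm_root_mul // count_norm_root_free_mul //.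
by rewrite (count_norm_root_mul f mp p0); ring.
Qed.

(** * The main identity *)

Lemma sum_pred1_npoly (N : nat) p (A : pred {poly F}) (phi : {poly F} -> int) :
  (size p <= N)%N -> (forall d, A d = (d == p)) ->
  \sum_(d : {poly_N F} | A (polyn d)) phi (polyn d) = phi p.
Proof.
move=> sp Ap; rewrite (big_pred1 (npolyp N p)) => [|d].
  by rewrite npolypK.
rewrite /= Ap; apply/eqP/eqP => [Dd|->]; last by rewrite npolypK.
by apply: val_inj; rewrite /= npolypK.
Qed.

Lemma monic_dvdp1 d : d \is monic -> (d %| 1) = (d == 1).
Proof. by move=> md; rewrite dvdp1 monic_size_eq1. Qed.

Lemma lambda_sum1 : lambda_sum 1 = 1.
Proof.
rewrite /lambda_sum.
rewrite (@sum_pred1_npoly _ 1 (fun d => inQ d && (d %| 1))) ?lambda1 //.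
move=> d; apply/andP/eqP => [[/inQ_symm/symm_monic md]|->].
  by rewrite monic_dvdp1 // => /eqP.
by rewrite inQ1 dvdpp.
Qed.

Lemma count_norm_root1 : count_norm_root 1 = 1.
Proof.
rewrite /count_norm_root (@sum_pred1_npoly _ 1 (norm_root 1) (fun=> 1)) //.
move=> g; apply/and3P/eqP => [[mg g0 /eqP Dg]|->].
  by apply/eqP; rewrite -monic_dvdp1 // -Dg dvdp_mulr.
by rewrite monic1 hornerC oner_eq0 star1 mulr1 eqxx.
Qed.

Lemma irreducible_symm_prime p : irreducible_poly p -> symm_prime p.
Proof. by move=> ip d _; rewrite coprimep_sym irreducible_poly_coprime. Qed.

(** A symmetric [d] is divisible by [p] exactly when it is divisible by [star p]. *)
Lemma symm_prime_mul_star p : p \is monic -> p.[0] != 0 -> irreducible_poly p ->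
  star p != p -> symm_prime (p * star p).
Proof.
move=> mp p0 ip np d sd; have is' := irreducible_star mp p0 ip.
have cop : coprimep p (star p).
  rewrite irreducible_poly_coprime //; apply: contraNN np => dp.
  by apply/eqP/esym/monic_irreducible_eq => //; apply: monic_star.
have E : (p %| d) = (star p %| d).
  have [d0 s0] := (symm_horner0 sd, star_horner0_neq0 p0).
  apply/idP/idP => dp; first by rewrite -(symm_star sd) star_dvdp.
  by rewrite -(symm_star sd) -(starK mp p0) star_dvdp.
rewrite Gauss_dvdp // -E andbb => npd.
by rewrite coprimepMr !(coprimep_sym d) !irreducible_poly_coprime // -E npd.
Qed.

Lemma even_palin_irreducible_dvd f : even_palin f -> (1 < size f)%N ->
  exists p, [/\ p \is monic, p.[0] != 0, irreducible_poly p & p %| f].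
Proof.
move=> Pf sf; have [p [mp ip dp]] := exists_irreducible sf.
exists p; split=> //; apply: dvdp_horner0_neq0 dp.
exact/symm_horner0/even_palin_symm.
Qed.

Lemma monic_irreducible_root p (c : F) : p \is monic -> irreducible_poly p ->
  p.[c] = 0 -> p = 'X - c%:P.
Proof.
move=> mp ip pc; apply/esym/monic_irreducible_eq; rewrite ?monicXsubC //.
  exact: irredp_XsubC.
by rewrite dvdp_XsubCl /root pc.
Qed.

(** Two functions obeying the same second-order recurrence along the powers of [S]
    agree at [S * f] if they agree at all smaller polynomials. *)
Lemma lambda_sum_count_norm_root_step S f :
  inQ S -> symm_prime S -> (1 < size S)%N -> even_palin (S * f) ->
  (forall e, (size e < size (S * f)%R)%N -> even_palin e ->
    lambda_sum e = count_norm_root e) ->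
  (forall e, e \is monic ->
    (~~ (S %| e) ->
       count_norm_root (S * e) = (lambda S + 1) * count_norm_root e) /\
    count_norm_root (S * (S * e)) =
      (lambda S + 1) * count_norm_root (S * e) - lambda S * count_norm_root e) ->
  lambda_sum (S * f) = count_norm_root (S * f).
Proof.
move=> QS pS sS TSf IH recG; have TS := inQ_even_palin QS.
have mS := symm_monic (inQ_symm QS).
have ltM e : e \is monic -> (size e < size (S * e)%R)%N.
  move=> me; rewrite size_mul_monic //; have := monic_size_gt0 me.
  by move: sS; move: (size S) (size e) => a b; lia.
have Pf : even_palin f by rewrite even_palinMl in TSf.
have mf := symm_monic (even_palin_symm Pf).
have [/dvdpP[e De]|nSf] := boolP (S %| f); last first.
  by rewrite (lambda_sum_rec QS pS mf).1 // (recG f mf).1 // IH ?ltM.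
rewrite mulrC in De; have Te : even_palin e by rewrite De even_palinMl in Pf.
have me := symm_monic (even_palin_symm Te).
rewrite De (lambda_sum_rec QS pS me).2 (recG e me).2 -De !IH ?ltM //.
by apply: ltn_trans (ltM _ mf); rewrite De ltM.
Qed.

(** Both sides are multiplicative. At the [k]-th power of an irreducible [p = star p]
    in Q they are 1 for even [k] and 0 for odd [k], at the [k]-th power of
    [p * star p] they are [k + 1], and both ignore the even powers of [X - 1] and
    [X + 1]. The induction peels off [p], [p * star p], or the square of
    [X - 1] or [X + 1]. *)
Lemma lambda_sum_count_norm_root f :
  even_palin f -> lambda_sum f = count_norm_root f.
Proof.
have [n] := ubnP (size f); elim: n f => // n IHn f ltfn Pf.
have IH e : (size e < size f)%N -> even_palin e ->
    lambda_sum e = count_norm_root e.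
  by move=> lte; apply: IHn; apply: leq_trans lte _; rewrite -ltnS.
have mf := symm_monic (even_palin_symm Pf).
have [sf|sf] := ltnP 1 (size f); last first.
  have -> : f = 1.
    by apply/eqP; rewrite -monic_size_eq1 // eqn_leq sf monic_size_gt0.
  by rewrite lambda_sum1 count_norm_root1.
have [p [mp p0 ip dp]] := even_palin_irreducible_dvd Pf sf.
have [sp|np] := eqVneq (star p) p.
  have symp : symm p by apply/symmP.
  (* Either [p] is in Q, and [lambda p = -1], or [p] is [X - 1] or [X + 1]. *)
  have [Qp|nQ] := boolP (inQ p).
    move: dp => /dvdpP[g Df]; rewrite mulrC in Df.
    rewrite Df; apply: lambda_sum_count_norm_root_step => //; rewrite -?Df //.
    - exact: irreducible_symm_prime.
    - by case: ip.
    move=> e me; rewrite (lambda_irreducible mp ip).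
    have [G1 G2] := count_norm_root_symm symp ip me.
    by split=> [/G1 ->|]; rewrite ?G2; ring.
  have [c c2 Dp] : exists2 c, c ^+ 2 = 1 & p = 'X - c%:P.
    move: nQ; rewrite /inQ symp /= negb_and !negbK => /orP[] /eqP pc.
      by exists 1; rewrite ?expr1n //; apply: monic_irreducible_root.
    by exists (-1); rewrite ?sqrrN ?expr1n //; apply: monic_irreducible_root.
  move: dp => /dvdpP[g Df]; rewrite mulrC Dp in Df.
  have /factor_theorem[e De] : root g c.
    by apply/eqP; apply: even_palin_XsubC => //; rewrite -Df.
  rewrite mulrC in De.
  have se : symm e.
    by move: (even_palin_symm Pf); rewrite Df De !symmMl ?symm_XsubC.
  have me := symm_monic se.
  rewrite Df De lambda_sum_XsubC ?monic_neq0 //.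
  rewrite (count_norm_root_symm _ _ me).2 -?Dp //.
  apply: IH.
    rewrite Df De !size_mul_monic ?monicMl ?monicXsubC // size_XsubC.
    by rewrite !addSn /= ltnW.
  have /and3P[_ f0 of_] := Pf.
  apply/and3P; split=> //.
    move: f0; rewrite Df De !hornerM hornerXsubC sub0r mulrA mulrNN -expr2 c2.
    by rewrite mul1r.
  move: of_; rewrite Df De !size_mul_monic ?monicMl ?monicXsubC // size_XsubC.
  by rewrite !addSn /= negbK.
(* Now [p] and [star p] are distinct irreducible divisors of [f], and [f] is
   divisible by their product. *)
pose S := p * star p.
have symS : symm S by apply: symm_mul_star.
have QS : inQ S.
  (* A root of [p] or [star p] at 1 or -1 would make it equal to [X - 1] or [X + 1],
     which [star] fixes. *)
  have nroot c : c ^+ 2 = 1 -> S.[c] != 0.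
    move=> c2; have symc := symm_XsubC c2.
    rewrite hornerM mulf_neq0 //; apply: contraNneq np => pc.
      have -> : p = 'X - c%:P by apply: monic_irreducible_root.
      by rewrite (symm_star symc).
    rewrite -{2}(starK mp p0).
    have -> : star p = 'X - c%:P.
      apply: monic_irreducible_root; rewrite ?monic_star //.
      exact: irreducible_star.
    by rewrite (symm_star symc).
  by rewrite /inQ symS !nroot // ?sqrrN expr1n.
have pS : symm_prime S by apply: symm_prime_mul_star.
have dS : S %| f.
  have sf' := even_palin_symm Pf; have f0 := symm_horner0 sf'.
  have dsp : star p %| f by rewrite -(symm_star sf') star_dvdp.
  rewrite /S Gauss_dvdp ?dp ?dsp //.
  rewrite irreducible_poly_coprime //; apply: contraNN np => dps.
  apply/eqP/esym/monic_irreducible_eq => //; first exact: monic_star.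
  exact: irreducible_star.
have lS : lambda S = 1.
  rewrite lambdaM ?monic_star // !lambda_irreducible ?mulrNN ?monic_star //.
  exact: irreducible_star.
move: dS => /dvdpP[g Df]; rewrite mulrC in Df.
rewrite Df; apply: lambda_sum_count_norm_root_step => //; rewrite -?Df //.
  rewrite size_mul_monic ?monic_star // size_star //.
  by case: ip => + _; move: (size p) => a; lia.
move=> e me; rewrite lS !mul1r; exact: count_norm_root_rec.
Qed.

Local Notation q := (#|F|%:R : int).

(** * Counting palindromic and monic polynomials *)

Lemma sum_npoly1 (m : nat) : \sum_(r : {poly_m F}) (1 : int) = q ^+ m.
Proof. by rewrite sumr_const card_npoly natrX. Qed.

Definition palin_deg m f := even_palin f && (size f == m.*2.+1).

(** The description by coefficients, suited to counting: the coefficients at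
    1, ..., [m] are free and determine the others. *)
Lemma palin_degP m f : palin_deg m f <->
  [/\ size f = m.*2.+1, f`_0 = 1, f`_m.*2 = 1 &
      forall i, (i <= m.*2)%N -> f`_i = f`_(m.*2 - i)].
Proof.
split=> [/andP[/and3P[symf /eqP f0 _] /eqP sf]|[sf f0 fm fi]].
  have mf := symm_monic symf.
  have lf : f`_m.*2 = 1 by have := monicP mf; rewrite lead_coefE sf.
  split; rewrite -?horner_coef0 // => i lei.
  by rewrite -[in LHS](symm_star symf) coef_star sf ?ltnS // f0 divr1.
have h0 : f.[0] = 1 by rewrite horner_coef0.
rewrite /palin_deg /even_palin h0 sf !eqxx /= odd_double /= !andbT.
apply/symmP; split; rewrite ?h0 ?oner_eq0 //.
  by rewrite monicE lead_coefE sf fm.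
apply/polyP => i; have [lti|lei] := ltnP i (size f); last first.
  by rewrite !nth_default ?size_star // h0 oner_eq0.
by rewrite coef_star // h0 divr1 sf /= -fi // -ltnS -sf.
Qed.

(** The free coefficients form [r : {poly_m F}]; with the constant coefficient 1 in
    front, they are the coefficients of [1 + r * X], and the coefficient at [i] of the
    palindromic polynomial is read at the distance of [i] to the nearest end. *)
Lemma count_palin (m : nat) :
  \sum_(f : {poly_m.*2.+1 F} | palin_deg m (polyn f)) (1 : int) = q ^+ m.
Proof.
pose h (r : {poly_m F}) : {poly_m.*2.+1 F} := npolyp m.*2.+1
  (\poly_(i < m.*2.+1) (1 + polyn r * 'X)`_(minn i (m.*2 - i))).
pose h' (f : {poly_m.*2.+1 F}) : {poly_m F} :=
  npolyp m (\poly_(i < m) (polyn f)`_i.+1).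
have hE r i : (i <= m.*2)%N ->
    (polyn (h r))`_i = (1 + polyn r * 'X)`_(minn i (m.*2 - i)).
  by move=> lei; rewrite coef_npolyp ltnS lei coef_poly ltnS lei.
have cE (r : {poly F}) j : (1 + r * 'X)`_j = if j == 0 then 1 else r`_j.-1.
  by rewrite coefD coef1 coefMX; case: j => [|j] /=; rewrite ?addr0 ?add0r.
rewrite (reindex_onto h h') => [|f /palin_degP[sf f0 fm fi]]; last first.
  apply: val_inj; apply/polyP => i /=.
  have [lei|lti] := leqP i m.*2; last first.
    by rewrite !nth_default // (leq_trans (size_npoly _)).
  rewrite hE // cE; case: eqP => [j0|/eqP j0].
    have [->|->] : i = 0%N \/ i = m.*2 by move: j0; lia.
      by rewrite f0.
    by rewrite fm.
  have ltj : ((minn i (m.*2 - i)).-1 < m)%N by move: j0; lia.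
  rewrite coef_npolyp ltj coef_poly ltj prednK ?lt0n //.
  by rewrite /minn; case: ifP => // _; rewrite -fi.
rewrite -sum_npoly1; apply: eq_bigl => r /=.
have c0 : (polyn (h r))`_0 = 1 by rewrite hE // min0n cE.
have cm : (polyn (h r))`_m.*2 = 1 by rewrite hE // subnn minn0 cE.
have Th : palin_deg m (polyn (h r)).
  apply/palin_degP; split=> // [|i lei]; last first.
    by rewrite !hE ?leq_subr // subKn // minnC.
  apply/eqP; rewrite eqn_leq size_npoly /= ltnNge; apply/negP => le_h.
  by move/eqP: cm; rewrite nth_default // eq_sym oner_eq0.
rewrite Th /=; apply/eqP/val_inj/polyP => i /=.
have [lei|lti] := leqP m i.
  by rewrite !nth_default // (leq_trans (size_npoly _)).
rewrite coef_npolyp lti coef_poly lti hE; last by lia.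
by rewrite cE (_ : minn _ _ = i.+1) //; lia.
Qed.

Definition monic_deg m f := (f \is monic) && (size f == m.+1).

Lemma count_monic (m : nat) :
  \sum_(f : {poly_m.+1 F} | monic_deg m (polyn f)) (1 : int) = q ^+ m.
Proof.
pose h (r : {poly_m F}) : {poly_m.+1 F} := npolyp m.+1 ('X^m + polyn r).
pose h' (f : {poly_m.+1 F}) : {poly_m F} :=
  npolyp m (\poly_(i < m) (polyn f)`_i).
have sh (r : {poly_m F}) : size ('X^m + polyn r) = m.+1.
  by rewrite size_polyDl size_polyXn // ltnS size_npoly.
have hE (r : {poly_m F}) : polyn (h r) = 'X^m + polyn r.
  by rewrite /h npolypK // sh.
rewrite (reindex_onto h h') => [|f /andP[mf /eqP sf]]; last first.
  apply: val_inj; apply/polyP => i /=.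
  rewrite hE coefD coefXn coef_npolyp coef_poly.
  case: (ltngtP i m) => [lti|gti|->].
  - by rewrite add0r.
  - by rewrite nth_default ?sf // addr0.
  by rewrite addr0; have := monicP mf; rewrite lead_coefE sf.
rewrite -sum_npoly1; apply: eq_bigl => r /=.
apply/andP; split.
  rewrite /monic_deg hE sh eqxx andbT monicE lead_coefDl ?lead_coefXn //.
  by rewrite size_polyXn ltnS size_npoly.
apply/eqP/val_inj/polyP => i /=.
rewrite coef_npolyp coef_poly hE coefD coefXn.
case: ltngtP => [lti|gti|->]; rewrite ?add0r //.
  by rewrite nth_default // (leq_trans (size_npoly _)) // ltnW.
by rewrite nth_default // size_npoly.
Qed.

(** Multiplication by [X] identifies the polynomials vanishing at 0 with the monic
    polynomials of degree one less. *)
Lemma count_monic0 (m : nat) :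
  \sum_(f : {poly_m.+2 F} | monic_deg m.+1 (polyn f) && ((polyn f).[0] != 0))
     (1 : int) = q ^+ m.+1 - q ^+ m.
Proof.
rewrite -(count_monic m.+1).
rewrite [X in _ = X - _](bigID
  (fun f : {poly_m.+2 F} => (polyn f).[0] == 0)) /=.
rewrite (@sum_mulp m.+1 m.+2 'X (monic_deg m)
  (fun f => monic_deg m.+1 f && (f.[0] == 0)) (fun=> 1)) ?polyX_eq0 //.
- by rewrite count_monic addrC addrK.
- move=> e; rewrite /monic_deg monicMl ?monicX //.
  rewrite hornerM hornerX mul0r eqxx andbT.
  by apply: andb_id2l => me; rewrite size_mul_monic ?monicX // size_polyX eqSS.
- by move=> d /andP[_ d0]; rewrite -['X]subr0 dvdp_XsubCl.
- by move=> e /andP[_ /eqP->].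
by move=> e /andP[/andP[_ /eqP->]].
Qed.

(** * Summing the main identity *)

(** The sum of [lambda_sum] over the palindromic polynomials of degree [2m], after
    exchanging the sums: a divisor [d] of degree [2k] has [q^(m - k)] palindromic
    multiples. As [d] has odd size [2k + 1], [(size d)./2] is [k]. *)
Definition weighted_Qsum m : int :=
  \sum_(d : {poly_m.*2.+1 F} | inQ (polyn d))
     lambda (polyn d) * q ^+ (m - (size (polyn d))./2).

Lemma sum_palin_lambda_sum m :
  \sum_(f : {poly_m.*2.+1 F} | palin_deg m (polyn f)) lambda_sum (polyn f) =
  weighted_Qsum m.
Proof.
have palin_neq0 f : palin_deg m f -> f != 0.
  by case/andP=> /even_palin_symm/symm_monic/monic_neq0.
rewrite (eq_bigr (fun f : {poly_m.*2.+1 F} => \sum_(d : {poly_m.*2.+1 F} |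
    inQ (polyn d) && (polyn d %| polyn f)) lambda (polyn d))); last first.
  move=> f Pf; have f0 := palin_neq0 _ Pf.
  apply: (@sum_npoly_eq _ _ (fun d => inQ d && (d %| polyn f))).
    move=> e /andP[_ /(dvdp_leq f0)] /leq_trans-> //; exact: size_npoly.
  by move=> e /andP[_ /(dvdp_leq f0)].
rewrite (exchange_big_dep
  (fun d : {poly_m.*2.+1 F} => inQ (polyn d))) /=; last first.
  by move=> f d _ /andP[].
apply: eq_bigr => d Qd; rewrite Qd.
have Td := inQ_even_palin Qd; have md := symm_monic (even_palin_symm Td).
have [k sd] : exists k, size (polyn d) = k.*2.+1.
  exists (size (polyn d))./2; have /and3P[_ _ od] := Td.
  by rewrite -{1}(odd_double_half (size (polyn d))) od.
have lekm : (k <= m)%N by have := size_npoly d; rewrite sd; lia.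
rewrite (eq_bigr (fun=> lambda (polyn d) * 1)) => [|f _]; last by rewrite mulr1.
rewrite -mulr_sumr; congr (_ * _).
rewrite sd /= uphalf_double -count_palin.
rewrite (@sum_mulp (m - k).*2.+1 m.*2.+1 (polyn d) (palin_deg (m - k))
  (fun f => palin_deg m f && (polyn d %| f)) (fun=> 1)) ?monic_neq0 //.
- move=> e; rewrite dvdp_mulr // andbT /palin_deg even_palinMl //.
  apply: andb_id2l => Te.
  have me := symm_monic (even_palin_symm Te); rewrite size_mul_monic // sd.
  by move: (size e) => a; apply/eqP/eqP; lia.
- by move=> f /andP[].
- by move=> f /andP[_ /eqP->].
by move=> f /andP[/andP[_ /eqP->]].
Qed.

(** Each monic [g] of degree [m] with [g(0) <> 0] is counted once, at
    [f = g * star g]. *)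
Lemma sum_palin_count_norm_root m :
  \sum_(f : {poly_m.*2.+1 F} | palin_deg m (polyn f)) count_norm_root (polyn f) =
  \sum_(g : {poly_m.+1 F} | monic_deg m (polyn g) && ((polyn g).[0] != 0)) 1.
Proof.
have ss g : g \is monic -> g.[0] != 0 -> size (g * star g) = (size g).*2.-1.
  by move=> mg g0; rewrite size_mul_monic ?monic_star // size_star // addnn.
have ssf f g : palin_deg m f -> norm_root f g -> size g = m.+1.
  case/andP=> _ /eqP sf /and3P[mg g0 /eqP Df].
  by move: sf (monic_size_gt0 mg); rewrite -Df ss //; move: (size g) => a; lia.
rewrite (eq_bigr (fun f : {poly_m.*2.+1 F} =>
    \sum_(g : {poly_m.+1 F} | norm_root (polyn f) (polyn g)) 1)); last first.
  move=> f Pf; apply: (@sum_npoly_eq _ _ (norm_root (polyn f)) (fun=> 1)).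
    by move=> g /(ssf _ _ Pf) ->.
  exact: size_norm_root.
rewrite (exchange_big_dep (fun g : {poly_m.+1 F} =>
    monic_deg m (polyn g) && ((polyn g).[0] != 0))) /=; last first.
  move=> f g Pf sfg; rewrite /monic_deg (ssf _ _ Pf sfg) eqxx.
  by case/and3P: sfg => -> ->.
apply: eq_bigr => g /andP[/andP[mg /eqP sg] g0].
have sgg : size (polyn g * star (polyn g)) = m.*2.+1 by rewrite ss // sg.
apply: (@sum_pred1_npoly _ (polyn g * star (polyn g))
  (fun f => palin_deg m f && norm_root f (polyn g)) (fun=> 1)).
  by rewrite sgg.
move=> f; rewrite /norm_root mg g0 /= [f == _]eq_sym andbC.
apply: andb_idr => /eqP <-.
rewrite /palin_deg /even_palin symm_mul_star // horner0_mul_star //.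
by rewrite sgg !eqxx /= odd_double.
Qed.

Definition Qsum n : int :=
  \sum_(d : {poly_n.+1 F} | inQ (polyn d) && (size (polyn d) == n.+1))
    lambda (polyn d).

Lemma sum_monic_size1 (B : pred {poly F}) :
  B 1 -> (forall d, B d -> d \is monic) ->
  \sum_(d : {poly_1 F} | B (polyn d) && (size (polyn d) == 1))
     lambda (polyn d) = 1.
Proof.
move=> B1 mB; rewrite (@sum_pred1_npoly _ 1 (fun d => B d && (size d == 1))).
- exact: lambda1.
- by rewrite size_poly1.
move=> d; apply/andP/eqP => [[/mB md /eqP sd]|->]; last by rewrite size_poly1.
by apply/eqP; rewrite -monic_size_eq1 // sd.
Qed.

Lemma Qsum0 : Qsum 0 = 1.
Proof.
by apply: sum_monic_size1 => [|d /inQ_symm/symm_monic //]; apply: inQ1.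
Qed.

Lemma Qsum_odd n : odd n -> Qsum n = 0.
Proof.
move=> on; apply: big1 => d /andP[/inQ_even_palin/and3P[_ _ od] /eqP sd].
by move: od; rewrite sd /= on.
Qed.

Lemma weighted_Qsum0 : weighted_Qsum 0 = 1.
Proof.
rewrite -sum_palin_lambda_sum.
rewrite (@sum_pred1_npoly _ 1 (palin_deg 0) lambda_sum).
- exact: lambda_sum1.
- by rewrite size_poly1.
move=> d; apply/andP/eqP => [[/even_palin_symm/symm_monic md /eqP sd]|->].
  by apply/eqP; rewrite -monic_size_eq1 // sd.
by rewrite even_palin1 size_poly1.
Qed.

Lemma weighted_QsumS m : weighted_Qsum m.+1 = q ^+ m.+1 - q ^+ m.
Proof.
rewrite -sum_palin_lambda_sum -count_monic0 -sum_palin_count_norm_root.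
by apply: eq_bigr => f /andP[Pf _]; apply: lambda_sum_count_norm_root.
Qed.

(** Passing from [m] to [m + 1] multiplies the weight of the divisors of degree at
    most [2m] by [q], so that the difference isolates those of degree [2m + 2]. *)
Lemma Qsum_even m : Qsum m.+1.*2 = weighted_Qsum m.+1 - q * weighted_Qsum m.
Proof.
apply/eqP; rewrite eq_sym subr_eq; apply/eqP.
rewrite {1}/weighted_Qsum (bigID (fun d : {poly_m.+1.*2.+1 F} =>
  size (polyn d) == m.+1.*2.+1)) /=; congr (_ + _).
  apply: eq_bigr => d /andP[_ /eqP ->].
  rewrite -[(m.+1.*2.+1)./2]/(uphalf m.+1.*2) uphalf_double.
  by rewrite subnn expr0 mulr1.
pose A d := inQ d && (size d <= m.*2.+1)%N.
pose phi d : int := lambda d * q ^+ (m.+1 - (size d)./2).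
transitivity (\sum_(d : {poly_m.+1.*2.+1 F} | A (polyn d)) phi (polyn d)).
  apply: eq_bigl => d; apply: andb_id2l => /inQ_even_palin/and3P[_ _].
  by have := size_npoly d; move: (size (polyn d)) => a; lia.
rewrite (@sum_npoly_eq m.*2.+1 m.+1.*2.+1 A phi); try by move=> d /andP[_ sd];
  rewrite (leq_trans sd) // !doubleS !ltnS ltnW.
rewrite mulr_sumr; apply: eq_big => [d|d /andP[/inQ_even_palin Qd sd]].
  by rewrite /A size_npoly andbT.
have /and3P[_ _ od] := Qd.
rewrite /phi mulrCA -exprS -subSn //.
by move: od sd; move: (size (polyn d)) => a; lia.
Qed.

Lemma Qsum_value n :
  Qsum n = if n == 0%N then 1 else if n == 2%N then -1 else 0.
Proof.
have [on|en] := boolP (odd n).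
  by rewrite Qsum_odd //; case: n on => [|[|[|]]].
rewrite -(even_halfK en); case: (n./2) => [|[|m]]; first exact: Qsum0.
  rewrite Qsum_even weighted_QsumS weighted_Qsum0 expr0 expr1; ring.
by rewrite Qsum_even !weighted_QsumS !exprS; ring.
Qed.

(** * From Q to all symmetric polynomials *)

Definition symm_sum (A : pred {poly F}) n : int :=
  \sum_(d : {poly_n.+1 F} |
     symm (polyn d) && A (polyn d) && (size (polyn d) == n.+1))
     lambda (polyn d).

Lemma symm_sum0 (A : pred {poly F}) : A 1 -> symm_sum A 0 = 1.
Proof.
move=> A1; apply: (@sum_monic_size1 (fun d => symm d && A d)).
  by rewrite symm1 A1.
by move=> d /andP[/symm_monic].
Qed.

(** The polynomials vanishing at [c] are the multiples of [X - c], an irreducible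
    symmetric polynomial with [lambda] equal to -1. *)
Lemma symm_sumS (A : pred {poly F}) (c : F) n : c ^+ 2 = 1 ->
  (forall d, symm d -> A (('X - c%:P) * d) = A d) ->
  symm_sum A n.+1 = symm_sum (fun d => A d && (d.[c] != 0)) n.+1 - symm_sum A n.
Proof.
move=> c2 AM; have symc := symm_XsubC c2; have mc := monicXsubC c.
rewrite {1}/symm_sum.
rewrite (bigID (fun d : {poly_n.+2 F} => (polyn d).[c] == 0)) /= addrC.
congr (_ + _).
  by apply: eq_bigl => d; rewrite -!andbA [(size _ == _) && _]andbC.
rewrite (@sum_mulp n.+1 n.+2 ('X - c%:P)
  (fun d => symm d && A d && (size d == n.+1))
  (fun d => symm d && A d && (size d == n.+2) && (d.[c] == 0)))
  ?polyXsubC_eq0 //.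
- rewrite -sumrN; apply: eq_bigr => d /andP[/andP[/symm_monic md _] _].
  by rewrite lambdaM // lambda_irreducible ?mulN1r //; apply: irredp_XsubC.
- move=> d; rewrite symmMl // hornerM hornerXsubC subrr mul0r eqxx andbT.
  rewrite -[LHS]andbA -[RHS]andbA.
  apply: andb_id2l => sd; rewrite AM //; congr (_ && _).
  by rewrite size_mul_monic ?(symm_monic sd) // size_XsubC.
- by move=> d /andP[_ dc]; rewrite dvdp_XsubCl.
- by move=> d /andP[_ /eqP->].
by move=> d /andP[/andP[_ /eqP->]].
Qed.

(** The condition [f(0) = 1] follows from [f(1) <> 0]. *)
Lemma sum_Qset n : \sum_(f in Qset F n) lambda (polyn f) = Qsum n.
Proof.
apply: eq_bigl => f; rewrite !inE.
have -> : inQ (polyn f) = [&& inQ (polyn f) & (polyn f).[0] == 1].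
  by apply/esym/andb_idr => /inQ_even_palin/and3P[].
rewrite /inQ /symm; case: (_ \is monic) => //=.
case: star_symmetric; rewrite ?andbF //=.
by case: (_ == n.+1); case: (_ == 1); rewrite ?andbF ?andbT.
Qed.

Lemma sum_Pstar n : \sum_(f in Pstar F n) lambda (polyn f) = symm_sum predT n.
Proof.
apply: eq_bigl => f; rewrite !inE andbT /symm -[RHS]andbA; congr (_ && _).
by rewrite andbC.
Qed.

Lemma dvd2_card : (2 %| #|F|)%N = ((1 : F) == -1).
Proof.
have [p pr_p pF] := finPcharP F.
have cF := card_pprimeChar pF.
have k0 : (0 < logn p #|F|)%N.
  by case: (logn _ _) cF (finNzRing_gt1 F) => [|//] ->.
have -> : ((1 : F) == -1) = (2%N \in [pchar F]).
  by rewrite -addr_eq0 inE /= -[1 + 1]/(2%:R).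
rewrite cF Euclid_dvdX // k0 andbT dvdn_prime2 //; apply/eqP/idP => [->|ch2] //.
by move: ch2; rewrite (pcharf_eq pF) => /eqP.
Qed.

Lemma symm_sum_root1_char2 n : (1 : F) == -1 ->
  symm_sum (fun d => d.[1] != 0) n = Qsum n.
Proof.
move=> /eqP ch2; apply: eq_bigl => d; congr (_ && _).
by rewrite /inQ -ch2 andbb.
Qed.

Lemma Qsum_symm n :
  symm_sum (fun d => (d.[1] != 0) && (d.[-1] != 0)) n = Qsum n.
Proof. by []. Qed.

Lemma symm_sum_Pstar n : symm_sum predT n.+1 =
   symm_sum (fun d => d.[1] != 0) n.+1 - symm_sum predT n.
Proof. by apply: symm_sumS; rewrite ?expr1n. Qed.

(** For [q] odd, multiplication by [X + 1] preserves the condition [f(1) <> 0]. *)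
Lemma symm_sum_odd n : (1 : F) != -1 ->
  symm_sum (fun d => d.[1] != 0) n.+1 =
    Qsum n.+1 - symm_sum (fun d => d.[1] != 0) n.
Proof.
move=> ch2; rewrite -Qsum_symm; apply: symm_sumS; first by rewrite sqrrN expr1n.
move=> d _; rewrite hornerM hornerXsubC mulf_eq0 negb_or.
by rewrite opprK addr_eq0 ch2.
Qed.

Lemma symm_sum_predT_value n : symm_sum predT n =
   if n == 0%N then 1
     else if (2 %| #|F|)%N then (if n == 1%N then -1 else 0)
     else 2 * (-1) ^+ n.
Proof.
have P0 := @symm_sum0 predT isT.
rewrite dvd2_card; have [ch2|ch2] := boolP (1 == -1).
  have PS k : symm_sum predT k.+1 = Qsum k.+1 - symm_sum predT k.
    by rewrite symm_sum_Pstar symm_sum_root1_char2.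
  have P1 : symm_sum predT 1 = -1 by rewrite PS P0 Qsum_value.
  have P2 : symm_sum predT 2 = 0 by rewrite PS P1 Qsum_value.
  case: n => [|[|n]] //=; elim: n => // n IH.
  by rewrite PS IH Qsum_value.
pose R := symm_sum (fun d => d.[1] != 0).
have R0 : R 0%N = 1 by apply: symm_sum0; rewrite hornerC oner_eq0.
have RS k : R k.+1 = Qsum k.+1 - R k by apply: symm_sum_odd.
have R1 : R 1%N = -1 by rewrite RS R0 Qsum_value.
have R2 k : R k.+2 = 0.
  by elim: k => [|k IH]; rewrite RS ?R1 ?IH Qsum_value.
have P1 : symm_sum predT 1 = - 2 by rewrite symm_sum_Pstar P0 -/R R1.
(* For odd [q], [R] is 1, -1, 0, 0, ..., so the sums over all symmetric polynomials
   alternate in sign from degree 1 on. *)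
case: n => [|n] //=; elim: n => [|n IH]; first by rewrite P1.
by rewrite symm_sum_Pstar -/R R2 IH [in RHS]exprS; ring.
Qed.

End Star.

Theorem proposition2p9 (F : finFieldType) (n : nat) :
  (\sum_(f in Qset F n) lambda (polyn f) =
     if n == 0%N then 1 else if n == 2%N then -1 else 0)
  /\
  (\sum_(f in Pstar F n) lambda (polyn f) =
     if n == 0%N then 1
     else if (2 %| #|F|)%N then (if n == 1%N then -1 else 0)
     else 2 * (-1) ^+ n).
Proof.
rewrite sum_Qset sum_Pstar; split; first exact: Qsum_value.
exact: symm_sum_predT_value.
Qed.
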